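(* Let $(\mathfrak{n},\langle\cdot,\cdot\rangle)$ be a pseudo-Riemannian Lie algebra where $\mathfrak{n}$ is $2$-step nilpotent and non-abelian. If the restriction of $\langle\cdot,\cdot\rangle$ to the center of $\mathfrak{n}$ is non-degenerate, then the $U$-tensor of $(\mathfrak{n},\langle\cdot,\cdot\rangle)$ is not associative; that is, it is not the case that $U(U(X,Y),Z)=U(X,U(Y,Z))$ for all $X,Y,Z\in\mathfrak{n}$.
   Context: A pseudo-Riemannian (metric) Lie algebra $(\mathfrak{n},\langle\cdot,\cdot\rangle)$ is a finite-dimensional real Lie algebra $\mathfrak{n}$ with a nondegenerate symmetric bilinear form $\langle\cdot,\cdot\rangle$ (of arbitrary signature). $2$-step nilpotent means $[\mathfrak{n},[\mathfrak{n},\mathfrak{n}]]=0$. The $U$-tensor is the symmetric part of the Levi-Civita connection, i.e. the symmetric bilinear map $U:\mathfrak{n}\times\mathfrak{n}\to\mathfrak{n}$ determined by $$2\langle U(X,Y),Z\rangle=\langle[Z,X],Y\rangle+\langle[Z,Y],X\rangle\qquad\text{for all }X,Y,Z\in\mathfrak{n}.$$ *)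

(* Defs.v *)
From HB Require Import structures.
From mathcomp Require Import all_boot all_order all_algebra.
From mathcomp Require Import sesquilinear boolp reals.

Set Implicit Arguments.
Unset Strict Implicit.
Unset Printing Implicit Defensive.

Import Order.TTheory GRing.Theory Num.Theory.
Local Open Scope ring_scope.

Section LieBracket.
Context {R : realType} {L : vectType R}.

Definition is_lie_bracket (br : {bilinear L -> L -> L}) : Prop :=
  (forall X, br X X = 0) /\
  (forall X Y Z, br X (br Y Z) + br Y (br Z X) + br Z (br X Y) = 0).

Definition abelian_lie (br : {bilinear L -> L -> L}) : Prop :=
  forall X Y, br X Y = 0.

Definition two_step_nilpotent (br : {bilinear L -> L -> L}) : Prop :=
  forall X Y Z, br X (br Y Z) = 0.

Definition ad (br : {bilinear L -> L -> L}) (X : L) : 'End(L) :=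
  linfun (br X).

Definition center (br : {bilinear L -> L -> L}) : {vspace L} :=
  lker (linfun (ad br)).

Lemma ad_is_linear br : linear (ad br).
Proof.
move=> a X Y; apply/lfunP => Z.
by rewrite add_lfunE scale_lfunE !lfunE /= linearPl.
Qed.

HB.instance Definition _ br :=
  GRing.isLinear.Build R L 'End(L) *:%R (ad br) (ad_is_linear br).

Lemma mem_center br X : X \in center br <-> (forall Y, br X Y = 0).
Proof.
rewrite memv_ker lfunE /=; split => [/eqP adX0 Y | brX0].
  by rewrite -[br X Y](lfunE (br X)) -/(ad br X) adX0 lfunE.
by apply/eqP/lfunP => Y; rewrite !lfunE /= brX0.
Qed.

End LieBracket.

Section Forms.
Context {R : realType} {L : vectType R}.

Lemma nondegenerate_formP (g : {symmetric L}) :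
  nondegenerate g <-> (forall X, (forall Y, g X Y = 0) -> X = 0).
Proof.
split=> [/eqP g0 X gX0 | g0].
  apply/eqP; rewrite -memv0 -g0.
  by apply/mem_orthovP => Y _; apply: gX0.
rewrite /nondegenerate -subv0; apply/subvP => X /mem_orthovP gX0.
by rewrite memv0; apply/eqP/g0 => Y; apply: gX0; rewrite memvf.
Qed.

Definition form_restr (g : {symmetric L}) (V : {vspace L})
  (u v : subvs_of V) : R := g (vsval u) (vsval v).

Lemma form_restr_is_bilinear g V :
  bilinear_for *%R (idfun \; *%R) (@form_restr g V).
Proof.
split=> [v a u1 u2 | u a v1 v2]; rewrite /form_restr linearP.
  exact: linearPl.
by [].
Qed.

HB.instance Definition _ g V :=
  bilinear_isBilinear.Build R (subvs_of V) (subvs_of V) R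
    *%R (idfun \; *%R) (@form_restr g V) (form_restr_is_bilinear g V).

Lemma form_restr_is_hermitian g V u v :
  @form_restr g V u v = (-1) ^+ false * idfun (@form_restr g V v u).
Proof. exact: hermitian_subproof. Qed.

HB.instance Definition _ g V :=
  isHermitianSesquilinear.Build R (subvs_of V) false idfun (@form_restr g V)
    (@form_restr_is_hermitian g V).

End Forms.

Lemma nondegenerate_form_restrP (R : realType) (L : vectType R)
    (g : {symmetric L}) (V : {vspace L}) :
  nondegenerate (@form_restr R L g V) <->
  (forall X, X \in V -> (forall Y, Y \in V -> g X Y = 0) -> X = 0).
Proof.
rewrite nondegenerate_formP; split=> [g0 X XV gX0 | g0 u gu0].
  have /(congr1 vsval) : Subvs XV = 0.
    by apply: g0 => v; apply: gX0; apply: subvsP.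
  by [].
apply: val_inj => /=; apply: g0 => [|Y YV]; first exact: subvsP.
exact: (gu0 (Subvs YV)).
Qed.

Section UTensor.
Context {R : realType} {L : vectType R}.
Implicit Types (br : {bilinear L -> L -> L}) (g : {symmetric L}).

Definition is_U_tensor br g (U : {bilinear L -> L -> L}) : Prop :=
  (forall X Y, U X Y = U Y X) /\
  (forall X Y Z, 2 * g (U X Y) Z = g (br Z X) Y + g (br Z Y) X).

Lemma U_tensor_unique br g U1 U2 : nondegenerate g ->
  is_U_tensor br g U1 -> is_U_tensor br g U2 -> forall X Y, U1 X Y = U2 X Y.
Proof.
move=> /nondegenerate_formP g0 [_ U1P] [_ U2P] X Y.
apply/eqP; rewrite -subr_eq0; apply/eqP/g0 => Z.
rewrite (@linearBl _ _ _ _ _ _ g); apply/eqP; rewrite subr_eq0.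
have h : 2 != 0 :> R by rewrite pnatr_eq0.
by apply/eqP/(mulfI h); rewrite U1P U2P.
Qed.

Lemma form_represent g (phi : {linear L -> R^o}) : nondegenerate g ->
  exists X, forall Z, g X Z = phi Z.
Proof.
move=> /nondegenerate_formP g0.
pose fl X : 'Hom(L, R^o) := linfun (g X : L -> R^o).
have gl X : linear (g X : L -> R^o).
  by move=> a u v; exact: (@linearPr _ _ _ _ _ _ g).
have flE X Z : fl X Z = g X Z.
  pose h := GRing.isLinear.Build R L R^o *:%R (g X) (gl X).
  pose gX : {linear L -> R^o} := HB.pack (g X : L -> R^o) h.
  exact: (lfunE gX Z).
have fll : linear fl.
  move=> a X Y; apply/lfunP => Z.
  by rewrite add_lfunE scale_lfunE !flE (@linearPl _ _ _ _ _ _ g).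
pose h := GRing.isLinear.Build R L 'Hom(L, R^o) *:%R fl fll.
pose fL : {linear L -> 'Hom(L, R^o)} := HB.pack fl h.
pose F := linfun fL.
have FE X Z : F X Z = g X Z by rewrite lfunE /= flE.
have kF : lker F == 0%VS.
  rewrite -subv0; apply/subvP => X; rewrite memv_ker memv0 => /eqP FX0.
  by apply/eqP/g0 => Z; rewrite -FE FX0 lfunE.
have iF : limg F = fullv.
  apply/eqP; rewrite eqEdim subvf /= limg_dim_eq; last first.
    by rewrite (eqP kF) capv0.
  by rewrite !dimvf /dim /= muln1.
have : linfun phi \in limg F by rewrite iF memvf.
case/memv_imgP => X _ phiX; exists X => Z.
by rewrite -FE -phiX lfunE.
Qed.

Lemma U_tensor_exists br g : nondegenerate g -> exists U, is_U_tensor br g U.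
Proof.
move=> ndg; have g0 := (nondegenerate_formP g).1 ndg.
have n2 : 2 != 0 :> R by rewrite pnatr_eq0.
have gP a X Y Z : g (a *: X + Y) Z = a * g X Z + g Y Z.
  exact: (@linearPl _ _ _ _ _ _ g).
have gPr a X Y Z : g Z (a *: X + Y) = a * g Z X + g Z Y.
  exact: (@linearPr _ _ _ _ _ _ g).
have bP a X Y Z : br (a *: X + Y) Z = a *: br X Z + br Y Z.
  exact: (@linearPl _ _ _ _ _ _ br).
have bPr a X Y Z : br Z (a *: X + Y) = a *: br Z X + br Z Y.
  exact: (@linearPr _ _ _ _ _ _ br).
pose q X Y Z : R^o := 2^-1 * (g (br Z X) Y + g (br Z Y) X).
have qlin X Y : linear (q X Y).
  move=> a Z1 Z2; rewrite /q !bP !gP -[a *: _]/(a * _).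
  by rewrite addrACA (mulrDr 2^-1) -(mulrDr a) [2^-1 * (a * _)]mulrCA.
have ex (p : L * L) : exists W,
    forall Z, 2 * g W Z = g (br Z p.1) p.2 + g (br Z p.2) p.1.
  pose h := GRing.isLinear.Build R L R^o *:%R (q p.1 p.2) (qlin p.1 p.2).
  pose Q : {linear L -> R^o} := HB.pack (q p.1 p.2) h.
  have [W WQ] := form_represent Q ndg.
  by exists W => Z; rewrite WQ /= /q mulVKf.
have [U0 U0P] := choice ex.
pose U X Y := U0 (X, Y).
have UP X Y Z : 2 * g (U X Y) Z = g (br Z X) Y + g (br Z Y) X by exact: U0P.
have eqU W1 W2 : (forall Z, 2 * g W1 Z = 2 * g W2 Z) -> W1 = W2.
  move=> W12; apply/eqP; rewrite -subr_eq0; apply/eqP/g0 => Z.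
  rewrite (@linearBl _ _ _ _ _ _ g); apply/eqP; rewrite subr_eq0.
  exact/eqP/(mulfI n2)/W12.
have UC X Y : U X Y = U Y X by apply: eqU => Z; rewrite !UP addrC.
have Ulin X : linear (U X).
  move=> a Y1 Y2; apply: eqU => Z.
  rewrite gP mulrDr mulrCA !UP bPr gP gPr mulrDr.
  by rewrite addrACA.
have Ubil : bilinear_for *:%R *:%R U.
  split=> [Y a X1 X2 | X]; last exact: Ulin.
  by rewrite /= !(UC _ Y) Ulin.
pose h := bilinear_isBilinear.Build R L L L *:%R *:%R U Ubil.
pose Ub : {bilinear L -> L -> L} := HB.pack U h.
by exists Ub; split.
Qed.

End UTensor.

(* Main.v *)
(** For central [Z], the vector [A = U X Z] satisfies [2 <A, W> = <[W, X], Z>],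
    so [A] is orthogonal to the center.  Since [U] vanishes on pairs of central
    vectors, associativity gives [U A Z' = U X (U Z Z') = 0] for central [Z'],
    that is, [<[W, A], Z'> = 0] for all [W]; nondegeneracy on the center forces
    [[W, A] = 0].  So [A] is central and orthogonal to the center, hence zero.
    Then [<[W, X], Z> = 0] for all central [Z], so [[W, X] = 0]. *)
Require Import Defs.
From mathcomp Require Import all_boot all_order all_algebra.
From mathcomp Require Import sesquilinear reals.

Set Implicit Arguments.
Unset Strict Implicit.
Unset Printing Implicit Defensive.

Import GRing.Theory Num.Theory.
Local Open Scope ring_scope.

Section TwoStepNilpotent.
Context {R : realType} {L : vectType R}.
Variables (br : {bilinear L -> L -> L}) (g : {symmetric L}).
Hypothesis br_lie : is_lie_bracket br.

Lemma lie_bracketC X Y : br X Y = - br Y X.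
Proof.
have [brxx _] := br_lie.
have := brxx (X + Y).
rewrite (@linearDr _ _ _ _ _ _ br) !(@linearDl _ _ _ _ _ _ br) !brxx.
by rewrite add0r addr0 addrC => /eqP; rewrite addr_eq0 => /eqP.
Qed.

Lemma center_bracketr X Y : Y \in center br -> br X Y = 0.
Proof. by move=> /mem_center YC; rewrite lie_bracketC YC oppr0. Qed.

Lemma bracket_in_center X Y : two_step_nilpotent br -> br X Y \in center br.
Proof. by move=> br2; apply/mem_center => W; rewrite lie_bracketC br2 oppr0. Qed.

Variable U : {bilinear L -> L -> L}.
Hypothesis UP : is_U_tensor br g U.

(** The second term of the defining identity contains [br W Z], which vanishes for central [Z]. *)
Lemma U_tensor_centerr X Z W :
  Z \in center br -> 2 * g (U X Z) W = g (br W X) Z.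
Proof.
have [_ ->] := UP => /center_bracketr ->.
by rewrite (@linear0l _ _ _ _ _ _ g) addr0.
Qed.

Lemma U_tensor_center Z1 Z2 : nondegenerate g ->
  Z1 \in center br -> Z2 \in center br -> U Z1 Z2 = 0.
Proof.
move=> /nondegenerate_formP g0 Z1C Z2C; apply: g0 => W.
have n2 : 2 != 0 :> R by rewrite pnatr_eq0.
apply: (mulfI n2); rewrite U_tensor_centerr // center_bracketr //.
by rewrite (@linear0l _ _ _ _ _ _ g) mulr0.
Qed.

End TwoStepNilpotent.

Theorem proposition6p1 (R : realType) (L : vectType R)
    (br : {bilinear L -> L -> L}) (g : {symmetric L})
    (U : {bilinear L -> L -> L}) :
  is_lie_bracket br ->
  nondegenerate g ->
  two_step_nilpotent br ->
  ~ abelian_lie br ->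
  nondegenerate (form_restr g (V := center br)) ->
  is_U_tensor br g U ->
  ~ (forall X Y Z : L, U (U X Y) Z = U X (U Y Z)).
Proof.
move=> brL ndg br2 nab /nondegenerate_form_restrP gC0 UP UA; apply: nab.
have n2 : 2 != 0 :> R by rewrite pnatr_eq0.
have brC X Y := bracket_in_center brL X Y br2.
have UC0 X Z : Z \in center br -> U X Z = 0.
  move=> ZC; apply: (gC0) => [|W WC].
    apply/mem_center => W; rewrite (lie_bracketC brL).
    suff -> : br W (U X Z) = 0 by rewrite oppr0.
    (* This bracket is central by 2-step nilpotency, so pairing it with central [Z'] suffices. *)
    apply: (gC0) => // Z' Z'C; rewrite -(U_tensor_centerr brL UP) //.
    rewrite UA (U_tensor_center brL UP ndg ZC Z'C) (@linear0r _ _ _ _ _ _ U).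
    by rewrite (@linear0l _ _ _ _ _ _ g) mulr0.
  (* Orthogonality to the center: [br W X] vanishes for central [W]. *)
  apply: (mulfI n2); rewrite (U_tensor_centerr brL UP) //.
  have /mem_center -> := WC.
  by rewrite (@linear0l _ _ _ _ _ _ g) mulr0.
(* Brackets are central, so nondegeneracy on the center detects them. *)
move=> W X; apply: (gC0) => // Z ZC.
by rewrite -(U_tensor_centerr brL UP) // UC0 // (@linear0l _ _ _ _ _ _ g) mulr0.
Qed.
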